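(* Let $d\ge 2$ be a natural number, $T_1,\dots,T_d>0$, and $[0,\mathbb{T}]_d:=[0,T_1]\times\dots\times[0,T_d]$. Let $W$ be a centered and continuous Gaussian random field on $\mathbb{R}_+^d$ with covariance function $q_W:\mathbb{R}_+^d\times\mathbb{R}_+^d\to\mathbb{R}$. Let $l_k=(l_k(x),\ x\in[0,T_k])$, $k=1,\dots,d$, be independent Lévy subordinators which are independent of $W$, and define $L(\underline{x}):=W(l_1(x_1),\dots,l_d(x_d))$ for $\underline{x}=(x_1,\dots,x_d)\in[0,\mathbb{T}]_d$. Assume that there exist a positive number $N\in\mathbb{N}$, coefficients $\{c_j,\ j=1,\dots,N\}\subset[0,+\infty)$ and exponents $\{\underline{\alpha}^{(j)},\ j=1,\dots,N\}\subset[0,+\infty)^d$ such that the pointwise variance function $\sigma_W^2$ of $W$ satisfies $$\sigma_W(\underline{x})=q_W(\underline{x},\underline{x})^{1/2}\le\sum_{j=1}^N c_j\,\underline{x}^{\underline{\alpha}^{(j)}}\quad\text{for all } x_1,\dots,x_d\ge0.$$ Consider a fixed point $\underline{x}\in[0,\mathbb{T}]_d$ and assume that the random variables $l_1(x_1),\dots,l_d(x_d)$ have densities $f_1^{x_1},\dots,f_d^{x_d}$ which satisfy $$f_i^{x_i}(z)\le C|z|^{-\eta_i}\quad\text{for } z\ge K,\ i=1,\dots,d,$$ with decay rates $\{\eta_i,\ i=1,\dots,d\}$, a finite constant $K>0$ and a finite constant $C>0$. Define $$a:=\min\Big\{\frac{\eta_i-1}{\alpha_i^{(j)}}\ \Big|\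 i=1,\dots,d,\ j=1,\dots,N,\ \alpha_i^{(j)}\ne0\Big\}.$$ Then the random variable $L(\underline{x})$ admits a $p$-th moment for every $p\in[1,a)$, i.e. $L(\underline{x})\in\mathcal{L}^p(\Omega;\mathbb{R})$ for $p\in[1,a)$.
   Context: $(\Omega,\mathcal{F},\mathbb{P})$ is a complete probability space and $\mathbb{R}_+:=[0,+\infty)$. For $\underline{x}\in\mathbb{R}_+^d$ and $\underline{\alpha}=(\alpha_1,\dots,\alpha_d)$ we write $\underline{x}^{\underline{\alpha}}=x_1^{\alpha_1}\cdots x_d^{\alpha_d}$ (with $0^0=1$). The minimum over an empty set is $+\infty$. A Gaussian random field on $\mathbb{R}_+^d$ is a family of real random variables all of whose finite-dimensional marginals are multivariate Gaussian; ''centered'' means zero mean, ''continuous'' means that its paths are $\mathbb{P}$-almost surely continuous, and $q_W(\underline{x},\underline{y})=\mathbb{E}(W(\underline{x})W(\underline{y}))$. $W$ is jointly measurable, i.e. $\mathcal{F}\otimes\mathcal{B}(\mathbb{R}_+^d)$-$\mathcal{B}(\mathbb{R})$-measurable. A Lévy process is a real-valued process $l$ with $l(0)=0$ a.s., independent and stationary increments, and stochastic continuity; a Lévy subordinator is a Lévy process that is $\mathbb{P}$-almost surely non-decreasing (so it takes values in $\mathbb{R}_+$). *)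

(* Defs.v *)
From HB Require Import structures.
From mathcomp Require Import all_boot all_order all_algebra.
From mathcomp Require Import all_classical all_reals all_analysis.

Set Implicit Arguments.
Unset Strict Implicit.
Unset Printing Implicit Defensive.

Import Order.TTheory GRing.Theory Num.Theory.
Import numFieldNormedType.Exports.

Local Open Scope classical_set_scope.
Local Open Scope ring_scope.

Definition orthant (R : realType) (n : nat) : set 'rV[R]_n :=
  [set x | forall i, 0 <= x ord0 i].

Arguments orthant : clear implicits.

Definition borel_rV (R : realType) (n : nat) :=
  g_sigma_algebraType (@open 'rV[R]_n).

(* x^alpha; [powR] satisfies 0 `^ 0 = 1 and 0 `^ r = 0 for r != 0. *)
Definition monomial (R : realType) (n : nat) (x : 'rV[R]_n) (alpha : 'I_n -> R)
    : R :=
  \prod_(i < n) (x ord0 i `^ alpha i).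

(* A process (or field) is a map X : I -> T -> R of which only the restriction
   to an index set D : set I is meaningful. *)

Section random_processes.
Context (disp : measure_display) (T : measurableType disp) (R : realType).
Variable P : probability T R.

Definition generated_sigma (I : Type) (D : set I) (X : I -> T -> R)
    : set_system T :=
  <<s \bigcup_(i in D) preimage_set_system setT (X i) measurable >>.

Definition independent2 (F G : set_system T) : Prop :=
  forall A B, F A -> G B -> P (A `&` B) = (P A * P B)%E.

Definition mutually_independent (I : finType) (F : I -> set_system T) : Prop :=
  forall (J : {set I}) (A : I -> set T), (forall i, i \in J -> F i (A i)) ->
    P (\bigcap_(i in [set` J]) A i) = (\prod_(i in J) P (A i))%E.

Definition same_law (X Y : T -> R) : Prop :=
  forall B : set R, measurable B -> P (X @^-1` B) = P (Y @^-1` B).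

(* [normal_prob m s] has standard deviation s. For s = 0 the library's value is
   not the degenerate Gaussian law, hence the separate Dirac case. *)
Definition gaussian_rv (X : T -> R) : Prop :=
  measurable_fun setT X /\
  exists m s : R, forall B : set R, measurable B ->
    P (X @^-1` B) = if s == 0 then dirac m B else normal_prob m s B.

Definition gaussian_vector (n : nat) (X : 'I_n -> T -> R) : Prop :=
  forall c : 'I_n -> R, gaussian_rv (fun w => \sum_(i < n) c i * X i w).

Definition gaussian_field (I : Type) (D : set I) (W : I -> T -> R) : Prop :=
  forall (n : nat) (x : 'I_n -> I), (forall i, D (x i)) ->
    gaussian_vector (fun i => W (x i)).

Definition centered_field (I : Type) (D : set I) (W : I -> T -> R) : Prop :=
  forall x, D x -> ('E_P[W x] = 0)%E.

Definition covariance_function (I : Type) (D : set I) (W : I -> T -> R)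
    (q : I -> I -> R) : Prop :=
  forall x y, D x -> D y -> ('E_P[W x \* W y] = (q x y)%:E)%E.

Definition continuous_field (I : topologicalType) (D : set I) (W : I -> T -> R)
    : Prop :=
  {ae P, forall w, {within D, continuous (fun x => W x w)}}.

Definition jointly_measurable (n : nat) (W : 'rV[R]_n -> T -> R) : Prop :=
  measurable_fun [set p : T * borel_rV R n | orthant R n p.2]
    (fun p : T * borel_rV R n => W p.2 p.1).

Definition levy_process (S : R) (l : R -> T -> R) : Prop :=
  [/\ forall t, t \in `[0, S] -> measurable_fun setT (l t),
      {ae P, forall w, l 0 w = 0},
      forall (n : nat) (t : nat -> R),
        (forall i, (i <= n)%N -> t i \in `[0, S]) ->
        (forall i, (i < n)%N -> t i < t i.+1) ->
        mutually_independent (fun i : 'I_n =>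
          preimage_set_system setT (l (t i.+1) \- l (t i)) measurable),
      forall s t, 0 <= s -> s <= t -> t <= S ->
        same_law (l t \- l s) (l (t - s) \- l 0) &
      forall t eps, t \in `[0, S] -> 0 < eps ->
        P [set w | eps < `|l s w - l t w|]
          @[s --> within [set` `[0, S]] (nbhs t)] --> 0%E].

Definition levy_subordinator (S : R) (l : R -> T -> R) : Prop :=
  levy_process S l /\
  {ae P, forall w, forall s t, 0 <= s -> s <= t -> t <= S -> l s w <= l t w}.

Definition has_density (X : T -> R) (f : R -> R) : Prop :=
  [/\ measurable_fun setT f, forall z, 0 <= f z &
      forall B : set R, measurable B ->
        P (X @^-1` B) = (\int[lebesgue_measure]_(z in B) (f z)%:E)%E].

Definition subordinated_field (n : nat) (W : 'rV[R]_n -> T -> R)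
    (l : 'I_n -> R -> T -> R) (x : 'rV[R]_n) (w : T) : R :=
  W (\row_i l i (x ord0 i) w) w.

End random_processes.

Definition moment_bound (R : realType) (n N : nat) (eta : 'I_n -> R)
    (alpha : 'I_N -> 'I_n -> R) : \bar R :=
  \big[Order.min/+oo%E]_(i < n)
    \big[Order.min/+oo%E]_(j < N | alpha j i != 0)
      ((eta i - 1) / alpha j i)%:E.

(* Main.v *)
(* Round each l_i(x_i) down to a finite grid of mesh 1/(n+1). The rounded point
   takes finitely many values, so independence of W turns the p-th moment of W
   there into a finite sum of Gaussian moments, each at most
   c0 (sum_j c_j y^alpha_j)^p; independence of the l_i then factors the sum into
   products of the moments E l_i^(alpha_i p), which are finite because
   alpha_i p + 1 < eta_i. Rounding down never increases these moments, so the
   bound is uniform in the mesh, and path continuity with Fatou's lemma passes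
   to the limit. The limit is only almost sure: its measurability comes from
   completeness of P. *)
Require Import Defs.
From HB Require Import structures.
From mathcomp Require Import all_boot all_order all_algebra.
From mathcomp Require Import all_classical all_reals all_analysis.
From mathcomp Require Import measurable_realfun ring lra.

Set Implicit Arguments.
Unset Strict Implicit.
Unset Printing Implicit Defensive.

Import Order.TTheory GRing.Theory Num.Theory.
Import numFieldNormedType.Exports.

Local Open Scope classical_set_scope.
Local Open Scope ring_scope.

Import HBNNSimple.

(** * Integrals of functions of a random variable: densities and independent events *)

(* The right-hand side depends on (mu, X, u) only through the image under X of
   the measure with density u. *)
Lemma integral_comp_weight (d : measure_display) (T : measurableType d)
    (R : realType) (mu : {measure set T -> \bar R}) (X u : T -> R) (g : R -> R)
    (mEg : measurable_fun setT (EFin \o g)) :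
  measurable_fun setT X -> measurable_fun setT u -> (forall w, 0 <= u w) ->
  (forall z, 0 <= g z) ->
  (\int[mu]_w (g (X w) * u w)%:E =
   limn (fun n => \sum_(y \in range (nnsfun_approx measurableT mEg n))
     (y%:E * \int[mu]_(w in X @^-1` (nnsfun_approx measurableT mEg n @^-1` [set y]))
        (u w)%:E)))%E.
Proof.
move=> mX mu_ u0 g0; set h := nnsfun_approx measurableT mEg.
have hg z : (EFin \o h n) z @[n --> \oo] --> (g z)%:E.
  by apply: (cvg_nnsfun_approx measurableT mEg) => // y _; rewrite lee_fin.
have hnd z a b : (a <= b)%N -> h a z <= h b z.
  by move=> ab; exact/lefP/nd_nnsfun_approx.
have mEu : measurable_fun setT (EFin \o u) by exact/measurable_EFinP.
have mhX n : measurable_fun setT (fun w => (h n (X w))%:E).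
  by apply/measurable_EFinP; exact: (measurableT_comp (measurable_funPT (h n)) mX).
(* Monotone convergence along the simple functions [h n] increasing to [g]; each [h n] is then
   expanded over its finite range. *)
transitivity (limn (fun n => \int[mu]_w ((h n (X w))%:E * (u w)%:E)))%E.
  rewrite -monotone_convergence//=.
  - apply: eq_integral => w _; apply/esym/cvg_lim => //; rewrite EFinM.
    by apply: cvgeZr => //; exact: hg.
  - by move=> n; exact: emeasurable_funM.
  - by move=> n w _; apply: mule_ge0; rewrite lee_fin.
  - by move=> w _ a b ab; rewrite lee_wpmul2r ?lee_fin ?hnd.
congr (limn _); apply/funext => n.
have mh1 y : measurable (h n @^-1` [set y]) by [].
have mh y : measurable (X @^-1` (h n @^-1` [set y])).
  rewrite -[X in measurable X]setTI; exact: mX.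
have mi y : measurable_fun setT (fun w => \1_(h n @^-1` [set y]) (X w) : R).
  apply: (measurableT_comp _ mX).
  exact: measurable_indic (mh1 y).
transitivity (\int[mu]_w
   (\sum_(y \in range (h n)) (y * \1_(h n @^-1` [set y]) (X w))%:E * (u w)%:E))%E.
  apply: eq_integral => w _; rewrite -ge0_mule_fsuml.
    by congr *%E; rewrite [in LHS]fimfunE -fsumEFin.
  by move=> y; exact: nnfun_muleindic_ge0.
rewrite ge0_integral_fsum//; last 2 first.
- move=> y; apply: emeasurable_funM => //; apply/measurable_EFinP.
  by apply: measurable_funM => //; exact: mi.
- by move=> y w _; apply: mule_ge0; [exact: nnfun_muleindic_ge0|rewrite lee_fin].
apply: eq_fsbigr => y _.
(* A negative [y] is not a value of the nonnegative [h n], so both sides vanish. *)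
have [y0|y0] := ltP y 0.
  rewrite preimage_nnfun0// preimage_set0 integral_set0 mule0.
  by apply: integral0_eq => w _; rewrite indic0 mulr0 mul0e.
under eq_integral do rewrite EFinM -muleA.
rewrite ge0_integralZl//.
- congr *%E; rewrite [RHS]integral_mkcond; apply: eq_integral => w _.
  by rewrite epatch_indic muleC.
- by apply: emeasurable_funM => //; apply/measurable_EFinP; exact: mi.
- by move=> w _; rewrite mule_ge0 ?lee_fin.
Qed.

(** Common source of the next two results. Weight 1 under [P] against a density under Lebesgue
    measure gives the density formula; the indicator of an event against its constant probability
    gives the product formula for independence. *)
Lemma eq_integral_comp_weight (d d' : measure_display) (T : measurableType d)
    (S : measurableType d') (R : realType) (mu : {measure set T -> \bar R})
    (nu : {measure set S -> \bar R}) (X u : T -> R) (Y v : S -> R) (g : R -> R) :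
  measurable_fun setT X -> measurable_fun setT u -> (forall w, 0 <= u w) ->
  measurable_fun setT Y -> measurable_fun setT v -> (forall w, 0 <= v w) ->
  measurable_fun setT g -> (forall z, 0 <= g z) ->
  (forall A : set R, measurable A ->
    \int[mu]_(w in X @^-1` A) (u w)%:E = \int[nu]_(w in Y @^-1` A) (v w)%:E)%E ->
  (\int[mu]_w (g (X w) * u w)%:E = \int[nu]_w (g (Y w) * v w)%:E)%E.
Proof.
move=> mX mu_ u0 mY mv v0 mg g0 uv.
have mEg : measurable_fun setT (EFin \o g) by exact/measurable_EFinP.
rewrite (integral_comp_weight _ mEg)// (integral_comp_weight _ mEg)//.
congr (limn _); apply/funext => n; apply: eq_fsbigr => y _.
by rewrite uv.
Qed.

Lemma integral_comp_density (d : measure_display) (T : measurableType d)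
    (R : realType) (P : probability T R) (X : T -> R) (f g : R -> R) :
  measurable_fun setT X -> has_density P X f ->
  measurable_fun setT g -> (forall z, 0 <= g z) ->
  (\int[P]_w (g (X w))%:E =
   \int[lebesgue_measure]_z (g z * f z)%:E)%E.
Proof.
move=> mX [mf f0 Pf] mg g0.
under eq_integral do rewrite -[g _]mulr1.
apply: (@eq_integral_comp_weight _ _ T _ R P (@lebesgue_measure R) X (cst 1) id f) => //.
move=> A mA; rewrite -Pf// -[RHS]mul1e -integral_cst//.
by rewrite -[X in measurable X]setTI; exact: mX.
Qed.

Lemma integral_comp_indep_event (d : measure_display) (T : measurableType d)
    (R : realType) (P : probability T R) (X : T -> R) (B : set T) (g : R -> R) :
  measurable_fun setT X -> measurable B ->
  measurable_fun setT g -> (forall z, 0 <= g z) ->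
  (forall A : set R, measurable A -> P (B `&` X @^-1` A) = (P B * P (X @^-1` A))%E) ->
  (\int[P]_w (g (X w) * \1_B w)%:E = P B * \int[P]_w (g (X w))%:E)%E.
Proof.
move=> mX mB mg g0 indep.
have fB : P B \is a fin_num by exact: fin_num_measure.
have pB : 0 <= fine (P B) by exact: fine_ge0.
transitivity (\int[P]_w (g (X w) * fine (P B))%:E)%E.
  apply: eq_integral_comp_weight => // A mA.
  have mXA : measurable (X @^-1` A) by rewrite -[X in measurable X]setTI; exact: mX.
  rewrite integral_indic// integral_cst// fineK//; exact: indep.
under eq_integral do rewrite EFinM muleC.
rewrite ge0_integralZl ?fineK//; last by move=> w _; rewrite lee_fin.
by apply/measurable_EFinP; exact: measurableT_comp.
Qed.

(** * Absolute moments of Gaussian variables *)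

(** From [ln y <= y] and [(y / 2 - r)^2 >= 0] one gets [r ln y <= r^2 + y^2 / 4]. The factor 1/4
    uses up only half of the Gaussian exponent [y^2 / 2]. *)
Lemma powR_le_expR_sqr (R : realType) (r y : R) : 0 <= r -> 0 <= y ->
  y `^ r <= expR (r ^+ 2) * expR (y ^+ 2 / 4).
Proof.
move=> r0; rewrite -expRD le_eqVlt => /predU1P[<-|y0].
  rewrite /powR eqxx (le_trans (y := 1)) ?lern1 ?leq_b1//.
  by rewrite -expR0 ler_expR addr_ge0 ?sqr_ge0// expr0n/= mul0r.
rewrite /powR gt_eqF// ler_expR.
have lny : r * ln y <= r * y by rewrite ler_wpM2l// ltW// ln_sublinear.
have := sqr_ge0 (y / 2 - r).
move: (ln y) lny => z; nra.
Qed.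

(* |z|^r <= exp(r^2) exp(z^2/4), and exp(z^2/4) turns the density of N(m, s^2)
   into sqrt 2 times that of N(m, 2 s^2). *)
Lemma normal_central_moment_le (d : measure_display) (T : measurableType d)
    (R : realType) (P : probability T R) (X : T -> R) (m s r : R) :
  measurable_fun setT X -> s != 0 -> has_density P X (normal_pdf m s) ->
  0 <= r ->
  (\int[P]_w (`|X w - m| `^ r)%:E <=
   (Num.sqrt 2 * expR (r ^+ 2) * `|s| `^ r)%:E)%E.
Proof.
move=> mX s0 hX r0.
have mg : measurable_fun setT (fun z : R => `|z - m| `^ r).
  apply: (measurableT_comp (measurable_powR r)).
  by apply: measurableT_comp => //; exact: measurable_funB.
rewrite (integral_comp_density mX hX mg); last by move=> z; exact: powR_ge0.
set c := Num.sqrt 2 * _ * _.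
have c0 : 0 <= c by rewrite !mulr_ge0 ?sqrtr_ge0 ?expR_ge0 ?powR_ge0.
have sq20 : Num.sqrt 2 != 0 :> R by rewrite gt_eqF// sqrtr_gt0.
set s' := Num.sqrt 2 * s.
have s'0 : s' != 0 by rewrite mulf_neq0.
have s'2 : s' ^+ 2 = 2 * s ^+ 2 by rewrite exprMn sqr_sqrtr.
(* Writing the bound as [c] times the total mass of N(m, 2 s^2) reduces the claim to a pointwise
   comparison of integrands. *)
rewrite -[leRHS]mule1 -(integral_normal_pdf m s').
have mpdf u : measurable_fun setT
    (fun z : R => (normal_pdf m u z)%:E).
  by apply/measurable_EFinP; exact: measurable_normal_pdf.
rewrite -ge0_integralZl ?lee_fin//; last 2 first.
- exact: mpdf.
- by move=> z _; rewrite lee_fin normal_pdf_ge0.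
apply: ge0_le_integral => //.
- by move=> z _; rewrite lee_fin mulr_ge0 ?powR_ge0 ?normal_pdf_ge0.
- by apply/measurable_EFinP; apply: measurable_funM => //; exact: measurable_normal_pdf.
- by apply: emeasurable_funM => //; exact: mpdf.
move=> z _; rewrite -EFinM lee_fin !normal_pdfE//.
have -> : normal_peak s = Num.sqrt 2 * normal_peak s'.
  rewrite /normal_peak s'2 [in RHS](_ : _ *+ 2 = 2 * (s ^+ 2 * pi *+ 2)); last by ring.
  by rewrite [in RHS]sqrtrM// invfM mulrA divff ?mul1r.
set y := `|z - m| / `|s|.
have ns : `|s| != 0 by rewrite normr_eq0.
have -> : `|z - m| = `|s| * y by rewrite mulrC divfK.
have y0 : 0 <= y by rewrite divr_ge0.
have ysE : (z - m) ^+ 2 = y ^+ 2 * s ^+ 2.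
  by rewrite -(real_normK (num_real s)) -exprMn divfK// real_normK// num_real.
have -> : normal_fun m s z = expR (- (y ^+ 2 / 2)).
  rewrite /normal_fun ysE; congr expR; field.
  by rewrite s0.
have -> : normal_fun m s' z = expR (- (y ^+ 2 / 4)).
  rewrite /normal_fun ysE s'2; congr expR; field.
  by rewrite s0.
rewrite powRM//.
have -> : - (y ^+ 2 / 2) = - (y ^+ 2 / 4) - y ^+ 2 / 4 by field.
rewrite expRD.
rewrite /c; set k := normal_peak s'.
have k0 : 0 <= k by exact: normal_peak_ge0.
have := powR_le_expR_sqr r0 y0.
rewrite -ler_pdivrMr ?expR_gt0// -expRN => h.
rewrite [leLHS](_ : _ = Num.sqrt 2 * `|s| `^ r * k * expR (- (y ^+ 2 / 4)) *
   (y `^ r * expR (- (y ^+ 2 / 4)))); last by ring.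
rewrite [leRHS](_ : _ = Num.sqrt 2 * `|s| `^ r * k * expR (- (y ^+ 2 / 4)) *
   expR (r ^+ 2)); last by ring.
by rewrite ler_wpM2l// !mulr_ge0 ?sqrtr_ge0 ?expR_ge0 ?powR_ge0.
Qed.
(* The density is at most 1/(2|s|), so at least half of the mass lies outside
   [-|s|/2, |s|/2]. *)
Lemma sqr_scale_le_second_moment (d : measure_display) (T : measurableType d)
    (R : realType) (P : probability T R) (X : T -> R) (m s q : R) :
  measurable_fun setT X -> s != 0 -> has_density P X (normal_pdf m s) ->
  (\int[P]_w (X w ^+ 2)%:E = q%:E)%E -> s ^+ 2 <= 8 * q.
Proof.
move=> mX s0 hX Xq.
set e := `|s| / 2.
have ns0 : 0 < `|s| by rewrite normr_gt0.
have e0 : 0 < e by rewrite divr_gt0.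
pose I : set R := `[- e, e]%classic.
have mI : measurable I by exact: measurable_itv.
have mXI : measurable (X @^-1` I) by rewrite -[X in measurable X]setTI; exact: mX.
have PI : (P (X @^-1` I) <= (2^-1)%:E)%E.
  have [_ _ ->//] := hX.
  apply: (@le_trans _ _ (\int[lebesgue_measure]_(z in I) (normal_peak s)%:E)%E).
    apply: ge0_le_integral => //.
    - by move=> z _; rewrite lee_fin normal_pdf_ge0.
    - apply: measurable_funTS; apply/measurable_EFinP; exact: measurable_normal_pdf.
    - by move=> z _; rewrite lee_fin normal_pdf_ub.
  rewrite integral_cst//= lebesgue_measure_itv/= lte_fin gtrN// -EFinB -EFinM lee_fin.
  (* [pi >= 2] bounds the peak by 1/(2|s|); the interval [I] has length |s|, hence mass at most
     1/2. *)
  have s2 : 2 * `|s| <= Num.sqrt (s ^+ 2 * pi *+ 2).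
    rewrite -[2 * _]ger0_norm ?mulr_ge0// -sqrtr_sqr ler_wsqrtr//.
    rewrite exprMn real_normK ?num_real//.
    have := pi_ge2 R; have := sqr_ge0 s; move: (s ^+ 2) => u u0 hp.
    by rewrite -mulr_natr; nra.
  have pk : normal_peak s <= (2 * `|s|)^-1.
    rewrite /normal_peak lef_pV2// posrE ?mulr_gt0//.
    by apply: lt_le_trans s2; rewrite mulr_gt0.
  have -> : 2^-1 = (2 * `|s|)^-1 * (e - - e) by rewrite /e; field; rewrite gt_eqF.
  by rewrite ler_wpM2r// subr_ge0 ltW// gtrN.
(* Integrate [e^2 <= X^2 + e^2 1_(|X| <= e)]. With [e^2 = s^2 / 4] and mass at most 1/2 this reads
   [s^2 / 4 <= q + s^2 / 8], whence the constant 8. *)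
have : ((e ^+ 2)%:E <= q%:E + (e ^+ 2)%:E * P (X @^-1` I))%E.
  rewrite -Xq -(setIT (X @^-1` I)) -integral_indic//.
  have mX2 : measurable_fun setT (fun w => (X w ^+ 2)%:E).
    by apply/measurable_EFinP; exact: measurable_funX.
  have mi : measurable_fun setT (fun w => (\1_(X @^-1` I) w)%:E : \bar R).
    by apply/measurable_EFinP; exact: measurable_indic.
  rewrite -ge0_integralZl ?lee_fin ?sqr_ge0//.
  rewrite -ge0_integralD//; last 3 first.
  - by move=> w _; rewrite lee_fin sqr_ge0.
  - by move=> w _; rewrite -EFinM lee_fin mulr_ge0 ?sqr_ge0.
  - exact: measurable_funeM.
  rewrite -[leLHS]mule1 -(probability_setT P) -integral_cst//.
  apply: ge0_le_integral => //.
  - by move=> w _; rewrite lee_fin sqr_ge0.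
  - by apply: emeasurable_funD => //; exact: measurable_funeM.
  move=> w _; rewrite -EFinM -EFinD lee_fin indicE.
  have [wI|wI] := boolP (w \in X @^-1` I); first by rewrite mulr1 lerDr sqr_ge0.
  rewrite mulr0 addr0 -(ger0_norm (ltW e0)) -(real_normK (num_real (X w))).
  rewrite lerXn2r ?nnegrE// ger0_norm ?(ltW e0)//.
  move: wI; rewrite notin_setE /= /I/= in_itv/= -ler_norml => /negP.
  by rewrite -ltNge => /ltW.
have fP : P (X @^-1` I) \is a fin_num by exact: fin_num_measure.
rewrite -(fineK fP) -EFinM -EFinD lee_fin in PI *.
move: PI; rewrite -(fineK fP) lee_fin.
have : e ^+ 2 = s ^+ 2 / 4 by rewrite /e expr_div_n real_normK ?num_real//; congr (_ / _); ring.
move=> -> ; move: (fine _) => t; have := sqr_ge0 s; move: (s ^+ 2) => u; nra.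
Qed.
(** The sum is at most [n] times its largest term, and the power of that term is one of the summands
    on the right. No convexity enters, so every [r >= 0] is allowed. *)
Lemma powR_sum_le (R : realType) (n : nat) (a : 'I_n -> R) (r : R) :
  (0 < n)%N -> 0 <= r -> (forall j, 0 <= a j) ->
  (\sum_j a j) `^ r <= n%:R `^ r * \sum_j a j `^ r.
Proof.
case: n a => // n a _ r0 a0.
case: (@Order.TotalTheory.arg_maxP _ _ 'I_n.+1 ord0 predT a) => // k _ kmax.
have sum_le : \sum_j a j <= n.+1%:R * a k.
  rewrite mulr_natl -[in leRHS](card_ord n.+1) -sumr_const.
  by apply: ler_sum => j _; exact: kmax.
apply: (@le_trans _ _ ((n.+1%:R * a k) `^ r)).
  by rewrite ge0_ler_powR ?nnegrE ?mulr_ge0 ?sumr_ge0.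
rewrite powRM// ler_wpM2l ?powR_ge0// (bigD1 k)//= lerDl sumr_ge0// => j _.
exact: powR_ge0.
Qed.

Lemma powRD_le (R : realType) (a b r : R) : 0 <= r -> 0 <= a -> 0 <= b ->
  (a + b) `^ r <= 2 `^ r * (a `^ r + b `^ r).
Proof.
move=> r0 a0 b0.
have := @powR_sum_le R 2 (fun j => if j == ord0 then a else b) r isT r0.
by rewrite !big_ord_recl !big_ord0 !addr0/=; apply => j; case: ifP.
Qed.

(** The law is given by [m] and [s], but the bound must be in terms of the second moment [q]. Both
    |m| and |s| are at most multiples of [sqrt q], and [|X|^r] is split into [|m|^r] and
    [|X - m|^r]. The constant depends on [r] only, hence serves all points of a field. *)
Lemma gaussian_moment_le (d : measure_display) (T : measurableType d)
    (R : realType) (P : probability T R) (r : R) : 0 <= r ->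
  exists2 c : R, 0 <= c & forall (X : T -> R) (q : R),
    gaussian_rv P X -> (\int[P]_w (X w ^+ 2)%:E = q%:E)%E ->
    (\int[P]_w (`|X w| `^ r)%:E <= (c * Num.sqrt q `^ r)%:E)%E.
Proof.
move=> r0.
pose D t : R := Num.sqrt 2 * expR (t ^+ 2).
have D0 t : 0 <= D t by rewrite mulr_ge0 ?sqrtr_ge0 ?expR_ge0.
(* [A] bounds [|m| / sqrt q], from [m^2 <= 2 q + 2 D(2) s^2] and [s^2 <= 8 q]; the 3 below is an
   upper bound for [sqrt 8], and the leading 1 covers the degenerate law. *)
pose A := Num.sqrt (2 + 16 * D 2).
exists (1 + 2 `^ r * (A `^ r + D r * 3 `^ r)).
  by rewrite addr_ge0// mulr_ge0 ?addr_ge0 ?mulr_ge0 ?powR_ge0.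
move=> X q [mX [m [s hB]]] Xq.
have mXr (a : R) : measurable_fun setT (fun z : R => `|z - a| `^ r).
  apply: (measurableT_comp (measurable_powR r)).
  by apply: measurableT_comp => //; exact: measurable_funB.
have mr : measurable_fun setT (fun z : R => `|z| `^ r).
  by apply: (measurableT_comp (measurable_powR r)).
have q0 : 0 <= q by rewrite -lee_fin -Xq integral_ge0// => w _; rewrite lee_fin sqr_ge0.
(* Degenerate case: the law is the Dirac mass at [m], so [q = m^2] and the moment is exactly
   [sqrt q] to the power [r]. *)
have [s0|s0] := eqVneq s 0.
  have dX (g : R -> R) : measurable_fun setT g -> (forall z, 0 <= g z) ->
      (\int[P]_w (g (X w))%:E = (g m)%:E)%E.
    move=> mg g0.
    have mEg : measurable_fun setT (EFin \o g) by exact/measurable_EFinP.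
    have := @ge0_integral_pushforward _ _ _ _ _ _ mX P setT (EFin \o g) measurableT mEg.
    rewrite preimage_setT => <-; last by move=> z _; rewrite lee_fin.
    rewrite (@eq_measure_integral _ _ _ _ (dirac m)).
      by rewrite integral_dirac// diracT mul1e.
    move=> B mB _; transitivity (P (X @^-1` B)) => //.
    by rewrite hB// s0 eqxx.
  have <- : m ^+ 2 = q.
    apply: EFin_inj; rewrite -Xq (dX (fun z => z ^+ 2))//; last by move=> z; exact: sqr_ge0.
  rewrite (dX (fun z => `|z| `^ r))//.
  rewrite sqrtr_sqr lee_fin ler_peMl ?powR_ge0// lerDl.
  by rewrite mulr_ge0 ?addr_ge0 ?mulr_ge0 ?powR_ge0.
have hX : has_density P X (normal_pdf m s).
  split; [exact: measurable_normal_pdf|by move=> z; exact: normal_pdf_ge0|].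
  by move=> B mB; rewrite hB// (negbTE s0).
have s2 := sqr_scale_le_second_moment mX s0 hX Xq.
have C2 := normal_central_moment_le mX s0 hX (ler0n _ 2).
have Cr := normal_central_moment_le mX s0 hX r0.
have mXm : measurable_fun setT (fun w => X w - m) by exact: measurable_funB.
have m2 : m ^+ 2 <= (2 + 16 * D 2) * q.
  apply: (@le_trans _ _ (2 * q + 2 * (D 2 * s ^+ 2))); last first.
    by have := D0 2; move: (D _) (s ^+ 2) s2 => u v; nra.
  rewrite -lee_fin EFinD (EFinM 2 q) (EFinM 2 (D 2 * _)) -Xq.
  have mX2 : measurable_fun setT (fun w => (X w ^+ 2)%:E).
    by apply/measurable_EFinP; exact: measurable_funX.
  have mXm2 : measurable_fun setT (fun w => (`|X w - m| `^ 2)%:E).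
    apply/measurable_EFinP; apply: (measurableT_comp (measurable_powR 2)).
    exact: measurableT_comp.
  rewrite -[leLHS]mule1 -(probability_setT P) -integral_cst//.
  (* Pointwise [m^2 <= 2 X^2 + 2 (X - m)^2], the difference being [(2 X - m)^2]. *)
  apply: (@le_trans _ _ (\int[P]_w (2%:E * (X w ^+ 2)%:E + 2%:E * (`|X w - m| `^ 2)%:E)))%E.
    apply: ge0_le_integral => //.
    - by move=> w _; rewrite lee_fin sqr_ge0.
    - by apply: emeasurable_funD; exact: measurable_funeM.
    move=> w _; rewrite -!EFinM -EFinD lee_fin powR_mulrn// real_normK ?num_real//.
    by have := sqr_ge0 (2 * X w - m); nra.
  rewrite ge0_integralD//; last 3 first.
  - by move=> w _; rewrite -EFinM lee_fin mulr_ge0 ?sqr_ge0.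
  - exact: measurable_funeM.
  - exact: measurable_funeM.
  rewrite !ge0_integralZl//; last by move=> w _; rewrite lee_fin sqr_ge0.
  apply: leeD => //; apply: lee_pmul => //.
  - by apply: integral_ge0 => w _; rewrite lee_fin powR_ge0.
  - move: C2; by rewrite -/(D 2) [`|s| `^ _](powR_mulrn 2)// real_normK ?num_real.
have mA : `|m| <= A * Num.sqrt q.
  by rewrite -sqrtrM ?addr_ge0 ?mulr_ge0// -sqrtr_sqr ler_wsqrtr.
have s3 : `|s| <= 3 * Num.sqrt q.
  rewrite -[3]ger0_norm// -!sqrtr_sqr -sqrtrM ?sqr_ge0// ler_wsqrtr//.
  by move: (s ^+ 2) s2 => u; lra.
apply: (@le_trans _ _ (2 `^ r * (`|m| `^ r + D r * `|s| `^ r))%:E)%E; last first.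
  rewrite lee_fin mulrDl mul1r -mulrA mulrDl -mulrA -!powRM ?sqrtr_ge0//.
  rewrite (@le_trans _ _ (2 `^ r * ((A * Num.sqrt q) `^ r + D r * (3 * Num.sqrt q) `^ r)))//.
    rewrite ler_wpM2l ?powR_ge0// lerD ?ler_wpM2l//;
      by rewrite ge0_ler_powR ?nnegrE ?mulr_ge0 ?sqrtr_ge0.
  by rewrite lerDr powR_ge0.
have mXmr : measurable_fun setT (fun w => (`|X w - m| `^ r)%:E).
  apply/measurable_EFinP; apply: (measurableT_comp (measurable_powR r)).
  exact: measurableT_comp.
apply: (@le_trans _ _ (\int[P]_w ((2 `^ r)%:E * ((`|m| `^ r)%:E + (`|X w - m| `^ r)%:E)))%E).
  apply: ge0_le_integral => //.
  - by apply/measurable_EFinP; exact: (measurableT_comp mr mX).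
  - by apply: measurable_funeM; exact: emeasurable_funD.
  move=> w _; rewrite -EFinD -EFinM lee_fin.
  apply: le_trans (powRD_le r0 (normr_ge0 _) (normr_ge0 _)).
  rewrite ge0_ler_powR ?nnegrE ?addr_ge0//.
  by rewrite (le_trans _ (ler_normD _ _))// addrC subrK.
rewrite ge0_integralZl ?lee_fin ?powR_ge0//; last 2 first.
- exact: emeasurable_funD.
- by move=> w _; rewrite -EFinD lee_fin addr_ge0 ?powR_ge0.
rewrite EFinM lee_pmul// ?lee_fin ?powR_ge0//.
  by apply: integral_ge0 => w _; rewrite -EFinD lee_fin addr_ge0 ?powR_ge0.
rewrite ge0_integralD//.
rewrite integral_cst// EFinD leeD// -[leRHS]mule1.
by apply: lee_pmul => //; exact: probability_le1.
Qed.

(** * Moments of a variable whose density has a power tail *)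

Lemma powRN_cvg0 (R : realType) (a : R) : 0 < a ->
  x `^ (- a) @[x --> +oo] --> (0 : R).
Proof.
move=> a0; apply/cvgr0Pnorm_le => e e0.
near=> x.
have x0 : 0 < x by near: x; exact: nbhs_pinfty_gt.
rewrite ger0_norm ?powR_ge0// powRN -[leRHS]invrK.
have e'0 : 0 < e^-1 by rewrite invr_gt0.
rewrite lef_pV2 ?posrE ?powR_gt0//.
have -> : e^-1 = (e^-1 `^ a^-1) `^ a.
  by rewrite -powRrM mulVf ?gt_eqF// powRr1// ltW.
rewrite ge0_ler_powR ?nnegrE ?powR_ge0 ?(ltW a0) ?(ltW x0)//.
Unshelve. all: by end_near. Qed.

(** The primitive [x^(1 - g) / (1 - g)] vanishes at infinity because [1 - g < 0]. *)
Lemma integral_powR_tail (R : realType) (K g : R) : 0 < K -> 1 < g ->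
  (\int[lebesgue_measure]_(x in `[K, +oo[) (x `^ (- g))%:E < +oo)%E.
Proof.
move=> K0 g1.
pose F (x : R) := (1 - g)^-1 * x `^ (1 - g).
have g0 : 1 - g != 0 by rewrite lt_eqF// subr_lt0.
have dp (a x : R) : 0 < x -> derivable ((powR (R:=R))^~ a) x 1.
  by move=> x0; apply: (@ex_derive _ _ _ _ _ _ _ (is_derive1_powR a x0)).
have dF x : 0 < x -> derivable F x 1.
  by move=> x0; apply: derivableM => //; exact: dp.
rewrite (@ge0_continuous_FTC2y _ _ F _ 0).
- by rewrite -EFinB ltry.
- by move=> x _; exact: powR_ge0.
- apply: derivable_within_continuous => x; rewrite in_itv/= andbT => Kx.
  by apply: dp; exact: lt_le_trans Kx.
- rewrite -(mulr0 (1 - g)^-1); apply: cvgMr.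
  by rewrite -opprB; apply: powRN_cvg0; rewrite subr_gt0.
- by move=> x Kx; apply: dF; exact: lt_trans Kx.
- apply: cvg_at_right_filter; apply: differentiable_continuous.
  by apply/derivable1_diffP; exact: dF.
- move=> x; rewrite in_itv/= andbT => Kx.
  have x0 := lt_trans K0 Kx.
  rewrite derive1E deriveM//; last exact: dp.
  rewrite derive_cst scaler0 addr0.
  rewrite (@derive_val _ _ _ _ _ _ _ (is_derive1_powR (1 - g) x0)).
  by rewrite /GRing.scale/= mulrA mulVf// mul1r addrAC subrr add0r.
Qed.

(** Below [K] the integrand is at most [K^b f], and [f] has mass 1; above [K] it is at most
    [C z^(b - h)], integrable since [h - b > 1]. The positive part appears because a subordinator is
    nonnegative only almost surely. *)
Lemma tail_moment_lty (d : measure_display) (T : measurableType d)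
    (R : realType) (P : probability T R) (X : T -> R) (f : R -> R)
    (K C b h : R) :
  measurable_fun setT X -> has_density P X f -> 0 < K -> 0 < C ->
  (forall z, K <= z -> f z <= C * `|z| `^ (- h)) ->
  0 <= b -> b + 1 < h ->
  (\int[P]_w ((Num.max (X w) 0) `^ b)%:E < +oo)%E.
Proof.
move=> mX hX K0 C0 hf b0 bh.
have [mf f0 Pf] := hX.
have mg : measurable_fun setT (fun z : R => Num.max z 0 `^ b).
  by apply: (measurableT_comp (measurable_powR b)); exact: measurable_maxr.
rewrite (integral_comp_density mX hX mg); last by move=> z; exact: powR_ge0.
pose tail (z : R) := C * (z `^ (- (h - b)) * \1_`[K, +oo[ z).
have tail0 z : 0 <= tail z by rewrite !mulr_ge0 ?powR_ge0// ltW.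
have mtail0 : measurable_fun setT (fun z : R => (z `^ (- (h - b)) * \1_`[K, +oo[ z)).
  apply: measurable_funM; first exact: measurable_powR.
  exact: measurable_indic.
have mtail : measurable_fun setT (EFin \o tail).
  by apply/measurable_EFinP; exact: measurable_funM.
have mKf : measurable_fun setT (fun z : R => (K `^ b)%:E * (f z)%:E)%E.
  by apply: measurable_funeM; exact/measurable_EFinP.
apply: (@le_lt_trans _ _
  (\int[lebesgue_measure]_z ((K `^ b)%:E * (f z)%:E + (tail z)%:E))%E).
  apply: ge0_le_integral => //.
  - by move=> z _; rewrite lee_fin mulr_ge0 ?powR_ge0.
  - by apply/measurable_EFinP; exact: measurable_funM.
  - by apply: emeasurable_funD.
  move=> z _; rewrite -EFinM -EFinD lee_fin.
  have [Kz|zK] := leP K z; last first.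
    apply: (@le_trans _ _ (K `^ b * f z)); last by rewrite lerDl.
    rewrite ler_wpM2r// ge0_ler_powR ?nnegrE ?le_max ?lexx ?orbT ?(ltW K0)//.
    by rewrite ge_max !ltW.
  have z0 : 0 < z by exact: lt_le_trans Kz.
  apply: (@le_trans _ _ (tail z)); last by rewrite lerDr mulr_ge0 ?powR_ge0.
  rewrite /tail indicE mem_set/= ?in_itv/= ?Kz// mulr1 max_l ?(ltW z0)//.
  rewrite opprB powRB; last by rewrite (gt_eqF z0) implybT.
  rewrite mulrCA ler_wpM2l ?powR_ge0//.
  by rewrite -powRN -[in leRHS](gtr0_norm z0) hf.
rewrite ge0_integralD//; last 2 first.
- by move=> z _; rewrite -EFinM lee_fin mulr_ge0 ?powR_ge0.
- by move=> z _; rewrite lee_fin.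
rewrite lte_add_pinfty//.
  rewrite ge0_integralZl ?lee_fin ?powR_ge0//; last 2 first.
  - exact/measurable_EFinP.
  - by move=> z _; rewrite lee_fin.
  by rewrite -Pf// preimage_setT lte_mul_pinfty ?lee_fin ?powR_ge0// probability_setT ltry.
under eq_integral do rewrite EFinM.
rewrite ge0_integralZl ?lee_fin ?(ltW C0)//; last 2 first.
- exact/measurable_EFinP.
- by move=> z _; rewrite lee_fin mulr_ge0 ?powR_ge0.
rewrite lte_mul_pinfty ?lee_fin ?(ltW C0)//.
rewrite [ltLHS](_ : _ =
    \int[lebesgue_measure]_(z in `[K, +oo[) (z `^ (- (h - b)))%:E)%E.
  by apply: integral_powR_tail => //; lra.
rewrite [RHS]integral_mkcond; apply: eq_integral => z _.
by rewrite epatch_indic -EFinM.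
Qed.

(** * Rounding down to a finite grid *)

(* Negative points and points beyond the grid are sent to the grid point 0
   ([truncn] and [inord] return 0 there), so that rounding never exceeds
   [max y 0]. *)
Definition grid_index (R : realType) (n : nat) (y : R) : 'I_(n.+1 * n.+1).+1 :=
  inord (Num.truncn (y * n.+1%:R)).

(** The [(n+1)^2 + 1] indices span [0, n+1] with mesh 1/(n+1), so the grid both refines and exhausts
    the half-line. *)
Definition grid_value (R : realType) (n : nat) (k : 'I_(n.+1 * n.+1).+1) : R :=
  k%:R / n.+1%:R.

Arguments grid_index {R} n y.
Arguments grid_value R {n} k.

Lemma grid_value_ge0 (R : realType) (n : nat) (k : 'I_(n.+1 * n.+1).+1) :
  0 <= grid_value R k.
Proof. by rewrite divr_ge0. Qed.

Lemma grid_value_index_le (R : realType) (n : nat) (y : R) :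
  grid_value R (grid_index n y) <= Num.max y 0.
Proof.
rewrite /grid_value ler_pdivrMr ?ltr0n// /grid_index /inord val_insubd.
have [y0|y0] := leP 0 y; last first.
  have /truncn0Pn -> : ~~ (1 <= y * n.+1%:R).
    rewrite -ltNge; apply: lt_trans ltr01.
    by rewrite pmulr_llt0 ?ltr0n.
  by rewrite mul0r.
case: ifP => _; last by rewrite mulr_ge0.
by rewrite truncn_le mulr_ge0.
Qed.

(** Once [n >= y] the point lies inside the grid and the rounding error is at most 1/(n+1). *)
Lemma grid_value_index_cvg (R : realType) (y : R) : 0 <= y ->
  grid_value R (grid_index n y) @[n --> \oo] --> y.
Proof.
move=> y0; apply/cvgrPdist_le => e e0; near=> n.
have n0 : 0 < n.+1%:R :> R by rewrite ltr0n.
have yn0 : 0 <= y * n.+1%:R by rewrite mulr_ge0.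
rewrite /grid_value /grid_index /inord val_insubd.
have -> : (Num.truncn (y * n.+1%:R) < (n.+1 * n.+1).+1)%N.
  rewrite truncn_lt_nat// (@le_lt_trans _ _ (n.+1 * n.+1)%:R) ?ltr_nat//.
  rewrite natrM ler_wpM2r//.
  apply: (@le_trans _ _ n%:R); last by rewrite ler_nat.
  by near: n; exact: nbhs_infty_ger.
have /andP[t1 t2] := truncn_itv yn0.
rewrite ger0_norm ?subr_ge0 ?ler_pdivrMr//.
rewrite lerBlDr -[leLHS](mulfK (lt0r_neq0 n0)) ler_pdivrMr// mulrDl divfK ?gt_eqF//.
apply: le_trans (ltW t2) _; rewrite -natr1 addrC lerD2r.
rewrite -ler_pdivrMl// mulr1; apply: (@le_trans _ _ n%:R); last by rewrite ler_nat.
by near: n; exact: nbhs_infty_ger.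
Unshelve. all: by end_near. Qed.

Lemma measurable_grid_index (R : realType) (n : nat) (k : 'I_(n.+1 * n.+1).+1) :
  measurable (grid_index n @^-1` [set k] : set R).
Proof.
have mgt m : measurable [set y : R | (m < Num.truncn (y * n.+1%:R))%N].
  have -> : [set y : R | (m < Num.truncn (y * n.+1%:R))%N] =
            (fun y => y * n.+1%:R) @^-1` `[m.+1%:R, +oo[.
    by apply/seteqP; split => y /=; rewrite truncn_gt_nat in_itv/= andbT.
  rewrite -[X in measurable X]setTI.
  exact: (measurable_funM (@measurable_id _ _ setT) (@measurable_cst _ _ _ _ setT _)).
have meq m : measurable [set y : R | Num.truncn (y * n.+1%:R) = m].
  case: m => [|m].
    have -> : [set y : R | Num.truncn (y * n.+1%:R) = 0%N] =
        ~` [set y : R | (0 < Num.truncn (y * n.+1%:R))%N].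
      by apply/seteqP; split => y /=; [move=> ->|case: Num.truncn].
    exact: measurableC.
  have -> : [set y : R | Num.truncn (y * n.+1%:R) = m.+1] =
      [set y : R | (m < Num.truncn (y * n.+1%:R))%N] `\`
      [set y : R | (m.+1 < Num.truncn (y * n.+1%:R))%N].
    apply/seteqP; split => y /=; first by move=> ->; split => //; rewrite ltnn.
    by move=> [mt /negP]; rewrite -leqNgt => tm; apply/eqP; rewrite eqn_leq tm mt.
  exact: measurableD.
(* A union over all [m] is taken since [inord] sends every out-of-range [m] to 0, so the cell of 0
   collects infinitely many level sets. *)
have -> : (grid_index n @^-1` [set k] : set R) =
    \bigcup_(m in [set m | inord m = k]) [set y : R | Num.truncn (y * n.+1%:R) = m].
  apply/seteqP; split => [y /= <-|y [m /= <- <-]//].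
  by exists (Num.truncn (y * n.+1%:R)).
by apply: bigcup_measurable => m _.
Qed.

(** * Moments of the field at the rounded point *)

Lemma powR_prod (R : realType) (I : finType) (a : I -> R) (r : R) :
  (forall i, 0 <= a i) -> (\prod_i a i) `^ r = \prod_i a i `^ r.
Proof.
move=> a0.
suff [] : 0 <= \prod_i a i /\ (\prod_i a i) `^ r = \prod_i a i `^ r by [].
apply: (big_ind2 (fun u v : R => 0 <= u /\ u `^ r = v)) => //.
- by split; rewrite ?powR1.
- by move=> u1 v1 u2 v2 [u10 <-] [u20 <-]; rewrite mulr_ge0// powRM.
Qed.

(** The sum is the [b]-th moment of the rounded variable, which never exceeds the positive part of
    [X]. *)
Lemma grid_moment (d : measure_display) (T : measurableType d)
    (R : realType) (P : probability T R) (X : T -> R) (n : nat) (b : R) :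
  measurable_fun setT X -> 0 <= b ->
  ((\sum_k fine (P (X @^-1` (grid_index n @^-1` [set k]))) * grid_value R k `^ b)%:E
   <= \int[P]_w ((Num.max (X w) 0) `^ b)%:E)%E.
Proof.
move=> mX b0.
have mk k : measurable (X @^-1` (grid_index n @^-1` [set k])).
  by rewrite -[X in measurable X]setTI; apply: mX => //; exact: measurable_grid_index.
have mi k : measurable_fun setT (\1_(X @^-1` (grid_index n @^-1` [set k])) : T -> R).
  exact: measurable_indic.
rewrite -sumEFin.
rewrite (eq_bigr (fun k => \int[P]_w (grid_value R k `^ b *
    \1_(X @^-1` (grid_index n @^-1` [set k])) w)%:E)%E); last first.
  move=> k _; rewrite mulrC EFinM fineK ?fin_num_measure//.
  under eq_integral do rewrite EFinM.
  rewrite ge0_integralZl ?lee_fin ?powR_ge0//; last exact/measurable_EFinP.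
  by rewrite integral_indic// setIT.
rewrite -ge0_integral_sum//; last first.
- by move=> k w _; rewrite lee_fin mulr_ge0 ?powR_ge0.
- by move=> k; apply/measurable_EFinP; exact: measurable_funM.
apply: ge0_le_integral => //.
- by move=> w _; apply: sume_ge0 => k _; rewrite lee_fin mulr_ge0 ?powR_ge0.
- apply: emeasurable_sum => k; apply/measurable_EFinP; exact: measurable_funM.
- apply/measurable_EFinP; apply: (measurableT_comp (measurable_powR b)).
  exact: measurable_maxr.
move=> w _; rewrite sumEFin lee_fin (bigD1 (grid_index n (X w)))//= big1 ?addr0.
  rewrite indicE mem_set// mulr1 ge0_ler_powR ?nnegrE ?grid_value_ge0 ?grid_value_index_le//.
  by rewrite le_max lexx orbT.
move=> k kw; rewrite indicE memNset ?mulr0//= => wk.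
by rewrite -wk eqxx in kw.
Qed.

Section sampling.
Context (disp : measure_display) (T : measurableType disp) (R : realType)
  (P : probability T R) (d : nat) (X : 'I_d -> T -> R)
  (W : 'rV[R]_d -> T -> R) (n : nat).

Local Notation cell_index := {ffun 'I_d -> 'I_(n.+1 * n.+1).+1}.

Definition grid_point (g : cell_index) : 'rV[R]_d := \row_i grid_value R (g i).

(** The intersection runs over the full [{set 'I_d}] to match the shape of
    [mutually_independent]. *)
Definition cell (g : cell_index) : set T :=
  \bigcap_(i in [set` (finset.setT : {set 'I_d})])
    (X i @^-1` (grid_index n @^-1` [set g i])).

Definition sampled_point (w : T) : 'rV[R]_d :=
  \row_i grid_value R (grid_index n (X i w)).

Lemma orthant_grid_point g : orthant R d (grid_point g).
Proof. by move=> i; rewrite mxE grid_value_ge0. Qed.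

Lemma orthant_sampled_point w : orthant R d (sampled_point w).
Proof. by move=> i; rewrite mxE grid_value_ge0. Qed.

Lemma cellP (g : cell_index) w :
  (w \in cell g) = (g == [ffun i => grid_index n (X i w)]).
Proof.
apply/idP/eqP => [|->].
  rewrite inE => gw; apply/ffunP => i; rewrite ffunE.
  by apply/esym; apply: gw; rewrite /= finset.in_setT.
by rewrite inE => i _; rewrite /= ffunE.
Qed.

(** The cells partition the space, so one term survives. Since [F] may depend on [w], taking [W^~ w]
    turns the field at a random point into a finite sum over fixed points. *)
Lemma sum_cell (F : 'rV[R]_d -> R) w :
  F (sampled_point w) = \sum_(g : cell_index) F (grid_point g) * \1_(cell g) w.
Proof.
rewrite (bigD1 [ffun i => grid_index n (X i w)])//= big1 ?addr0.
  rewrite indicE cellP eqxx mulr1; congr F.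
  by apply/rowP => i; rewrite !mxE ffunE.
by move=> g /negbTE gw; rewrite indicE cellP gw mulr0.
Qed.

Context (mX : forall i, measurable_fun setT (X i)).

Lemma measurable_cell g : measurable (cell g).
Proof.
apply: fin_bigcap_measurable => //= i _.
by rewrite -[X in measurable X]setTI; apply: mX => //; exact: measurable_grid_index.
Qed.

Context (mW : forall y, orthant R d y -> measurable_fun setT (W y)).

Lemma measurable_sampled_field :
  measurable_fun setT (fun w => W (sampled_point w) w).
Proof.
under eq_fun => w do rewrite (sum_cell (W^~ w)).
apply: measurable_sum => g; apply: measurable_funM.
  by apply: mW; exact: orthant_grid_point.
by apply: measurable_indic; exact: measurable_cell.
Qed.

Context (indep : forall g, P (cell g) =
    (\prod_i P (X i @^-1` (grid_index n @^-1` [set g i])))%E)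
  (indepW : forall g y A, orthant R d y -> measurable A ->
    P (cell g `&` W y @^-1` A) = (P (cell g) * P (W y @^-1` A))%E).

(** On each cell the evaluation point is deterministic, and the cell is independent of the field
    there. *)
Lemma integral_sampled_field (p : R) :
  (\int[P]_w (`|W (sampled_point w) w| `^ p)%:E =
   \sum_(g : cell_index) P (cell g) * \int[P]_w (`|W (grid_point g) w| `^ p)%:E)%E.
Proof.
have mp : measurable_fun setT (fun z : R => `|z| `^ p).
  exact: (measurableT_comp (measurable_powR p)).
transitivity (\int[P]_w (\sum_(g : cell_index)
    (`|W (grid_point g) w| `^ p * \1_(cell g) w)%:E))%E.
  by apply: eq_integral => w _; rewrite (sum_cell (fun y => `|W y w| `^ p)) sumEFin.
rewrite ge0_integral_sum//; last first.
  move=> g; apply/measurable_EFinP; apply: measurable_funM.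
    by apply: (measurableT_comp mp); apply: mW; exact: orthant_grid_point.
  by apply: measurable_indic; exact: measurable_cell.
apply: eq_bigr => g _.
apply: (@integral_comp_indep_event _ _ _ P (W (grid_point g)) (cell g) (fun z => `|z| `^ p)) => //.
- by apply: mW; exact: orthant_grid_point.
- exact: measurable_cell.
- by move=> A mA; apply: indepW => //; exact: orthant_grid_point.
Qed.

(** The estimate is uniform in the mesh: [n] occurs only on the left. Monomials are products over
    coordinates, as are cell probabilities, so the sum over cells splits into one-dimensional grid
    moments. *)
Lemma sampled_moment_le (p c0 : R) (N : nat) (c : 'I_N -> R)
    (alpha : 'I_N -> 'I_d -> R) (M : 'I_N -> 'I_d -> R) :
  0 <= p -> 0 <= c0 -> (0 < N)%N -> (forall j, 0 <= c j) ->
  (forall j i, 0 <= alpha j i) ->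
  (forall y, orthant R d y -> (\int[P]_w (`|W y w| `^ p)%:E <=
     (c0 * (\sum_j c j * monomial y (alpha j)) `^ p)%:E)%E) ->
  (forall j i, (\int[P]_w (Num.max (X i w) 0 `^ (alpha j i * p))%:E <=
     (M j i)%:E)%E) ->
  (\int[P]_w (`|W (sampled_point w) w| `^ p)%:E <=
   (c0 * (N%:R `^ p * \sum_j c j `^ p * \prod_i M j i))%:E)%E.
Proof.
move=> p0 c00 N0 c_ge0 alpha_ge0 Wp XM; rewrite integral_sampled_field.
pose pr i k := fine (P (X i @^-1` (grid_index n @^-1` [set k]))).
have pr_ge0 i k : 0 <= pr i k by exact: fine_ge0.
have Pcell g : P (cell g) = (\prod_i pr i (g i))%:E.
  rewrite indep -prodEFin; apply: eq_bigr => i _; rewrite fineK// fin_num_measure//.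
  by rewrite -[X in measurable X]setTI; apply: mX => //; exact: measurable_grid_index.
apply: (@le_trans _ _ (\sum_(g : cell_index) (\prod_i pr i (g i) *
    (c0 * (N%:R `^ p * \sum_j c j `^ p * \prod_i grid_value R (g i) `^ (alpha j i * p))))%:E)%E).
  apply: lee_sum => g _; rewrite Pcell EFinM lee_wpmul2l ?lee_fin ?prodr_ge0//.
  apply: le_trans (Wp _ (orthant_grid_point g)) _.
  rewrite lee_fin ler_wpM2l//.
  have mono_ge0 j : 0 <= monomial (grid_point g) (alpha j).
    by apply: prodr_ge0 => i _; exact: powR_ge0.
  apply: le_trans (powR_sum_le N0 p0 _) _; first by move=> j; rewrite mulr_ge0.
  rewrite ler_wpM2l ?powR_ge0//; apply: ler_sum => j _.
  rewrite powRM// /monomial powR_prod; last by move=> i; exact: powR_ge0.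
  by under eq_bigr do rewrite -powRrM mxE.
rewrite sumEFin lee_fin.
under eq_bigr do rewrite mulrCA (mulrCA _ (N%:R `^ p)).
rewrite -mulr_sumr -mulr_sumr ler_wpM2l// ler_wpM2l ?powR_ge0//.
under eq_bigr do rewrite mulr_sumr.
rewrite exchange_big/=; apply: ler_sum => j _.
under eq_bigr do rewrite mulrCA -big_split/=.
rewrite -mulr_sumr ler_wpM2l ?powR_ge0//.
(* Distributivity: a sum over all index functions [g] of products over [i] is the product over [i]
   of sums over [k]. *)
rewrite -(bigA_distr_bigA (fun i k => pr i k * grid_value R k `^ (alpha j i * p))).
apply: ler_prod => i _; apply/andP; split.
  by apply: sumr_ge0 => k _; rewrite mulr_ge0 ?powR_ge0.
rewrite -lee_fin; apply: le_trans (XM j i); apply: grid_moment => //.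
by rewrite mulr_ge0.
Qed.

End sampling.

(** * Passage to the limit *)

(** Away from 0 the power is differentiable, hence continuous; at the limit 0 the threshold
    [e^(1/p)] is used directly. *)
Lemma cvg_normr_powR (R : realType) (u : R ^nat) (l p : R) : 0 < p ->
  u @ \oo --> l -> `|u n| `^ p @[n --> \oo] --> `|l| `^ p.
Proof.
move=> p0 ul.
have nul : `|u n| @[n --> \oo] --> `|l| by exact: cvg_norm.
have [l0|l0] := eqVneq l 0; last first.
  have pc : {for `|l|, continuous (fun z : R => z `^ p)}.
    apply: differentiable_continuous; apply/derivable1_diffP.
    by apply: ex_derive; apply: is_derive1_powR; rewrite normr_gt0.
  exact: (@cvg_comp _ _ _ (fun n => `|u n|) (fun z => z `^ p) _ _ _ nul pc).
rewrite l0 normr0 powR0 ?gt_eqF//; rewrite l0 normr0 in nul.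
apply/cvgr0Pnorm_le => e e0; near=> n.
rewrite ger0_norm ?powR_ge0//.
have -> : e = (e `^ p^-1) `^ p by rewrite -powRrM mulVf ?gt_eqF// powRr1// ltW.
rewrite ge0_ler_powR ?nnegrE ?powR_ge0 ?(ltW p0)//.
rewrite -[leLHS]normr_id; near: n.
by move/cvgr0Pnorm_le : nul; apply; rewrite powR_gt0.
Unshelve. all: by end_near. Qed.

Lemma Lfun_ae_cvg (d : measure_display) (T : measurableType d) (R : realType)
    (mu : {measure set T -> \bar R}) (u : nat -> T -> R) (f : T -> R) (p B : R) :
  measure_is_complete mu -> 0 < p ->
  (forall n, measurable_fun setT (u n)) ->
  {ae mu, forall w, u n w @[n --> \oo] --> f w} ->
  (forall n, (\int[mu]_w (`|u n w| `^ p)%:E <= B%:E)%E) ->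
  f \in Lfun mu p%:E.
Proof.
move=> mu_complete p0 mu_ [N [mN N0 uN]] uB.
have mNC : measurable (~` N) by exact: measurableC.
have uf w : (~` N) w -> u n w @[n --> \oo] --> f w.
  by move=> Nw; apply: contrapT => /uN.
have mfN : measurable_fun (~` N) f.
  apply: (@measurable_fun_cvg _ _ _ (~` N) u) => // n.
  exact: measurable_funS (mu_ n).
have mf : measurable_fun setT f.
  (* Off [N] the preimage is measurable because [f] is a pointwise limit there; inside the null set
     [N] it is measurable by completeness. *)
  move=> _ Y mY; rewrite setTI -(setIT (f @^-1` Y)) -(setvU N) setIUr.
  apply: measurableU; first by rewrite setIC; exact: mfN.
  apply: mu_complete; exists N; split => //; exact: subIsetr.
have mp : measurable_fun setT (fun z : R => `|z| `^ p).
  exact: (measurableT_comp (measurable_powR p)).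
have mfp : measurable_fun setT (fun w => (`|f w| `^ p)%:E).
  by apply/measurable_EFinP; exact: (measurableT_comp mp mf).
have mup n : measurable_fun setT (fun w => (`|u n w| `^ p)%:E).
  by apply/measurable_EFinP; exact: (measurableT_comp mp (mu_ n)).
rewrite inE; apply/andP; split; rewrite inE//= /finite_norm unlock /Lnorm.
apply: poweR_lty; apply: (@le_lt_trans _ _ B%:E); last exact: ltry.
(* With [N] discarded, the integrand is everywhere the lower limit of those of [u n], as Fatou's
   lemma requires. *)
rewrite (ge0_negligible_integral mN)//; last by move=> w _; exact: poweR_ge0.
rewrite setTD.
rewrite (eq_integral (fun w => limn_einf (fun n => (`|u n w| `^ p)%:E))); last first.
  move=> w; rewrite inE => Nw; rewrite poweR_EFin.
  apply/esym; apply: (cvg_limn_einf_sup _).1.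
  apply/cvg_EFin; first exact: nearW.
  by apply: cvg_normr_powR => //; exact: uf.
apply: le_trans.
  apply: (@fatou _ _ _ mu (~` N) mNC (fun n w => (`|u n w| `^ p)%:E)).
  - by move=> n; exact: measurable_funS (mup n).
  - by move=> n w _; rewrite lee_fin powR_ge0.
(* The lower limit is the limit of tail infima, each at most its first term and so at most [B]. *)
rewrite limn_einf_lim; apply: lime_le; first exact: is_cvg_einfs.
near=> n; apply: le_trans (uB n).
apply: (@le_trans _ _ (\int[mu]_(w in ~` N) (`|u n w| `^ p)%:E)%E).
  by apply: ereal_inf_lbound; exists n => /=.
by apply: ge0_subset_integral => //; move=> w _; rewrite lee_fin powR_ge0.
Unshelve. all: by end_near. Qed.

(** * Moment condition, path convergence and the final assembly *)

Lemma moment_bound_lt (R : realType) (n N : nat) (eta : 'I_n -> R)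
    (alpha : 'I_N -> 'I_n -> R) (p : R) (i : 'I_n) (j : 'I_N) :
  0 <= alpha j i -> alpha j i != 0 -> (p%:E < moment_bound eta alpha)%E ->
  alpha j i * p + 1 < eta i.
Proof.
move=> a_ge0 a0; rewrite /moment_bound => /bigmin_gtP[_ /(_ i isT)].
move=> /bigmin_gtP[_ /(_ j a0)]; rewrite lte_fin.
by rewrite ltr_pdivlMr ?lt0r ?a0// => h; rewrite -ltrBrDr mulrC.
Qed.

Lemma cvg_row (R : realType) (d : nat) (y : nat -> 'I_d -> R) (l : 'I_d -> R) :
  (forall i, y n i @[n --> \oo] --> l i) ->
  (\row_i y n i) @[n --> \oo] --> (\row_i l i : 'rV[R]_d).
Proof.
move=> yl; apply/cvg_mx_entourageP => A eA.
have : \forall n \near \oo, forall i, (l i, y n i) \in A.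
  apply: filter_forall => i.
  have /cvg_app_entourageP /(_ A eA) := yl i.
  by apply: filterS => n ?; rewrite inE.
by apply: filterS => n h k i; rewrite !mxE.
Qed.

Lemma generated_sigma_preimage (disp : measure_display) (T : measurableType disp)
    (R : realType) (I : Type) (D : set I) (X : I -> T -> R) (t : I) (B : set R) :
  D t -> measurable B -> generated_sigma D X (X t @^-1` B).
Proof.
move=> Dt mB; apply: sub_sigma_algebra; exists t => //.
by exists B => //; rewrite setTI.
Qed.

(** Continuity holds only relative to the orthant; this suffices because rounded points never leave
    it. *)
Lemma sampled_point_cvg (disp : measure_display) (T : measurableType disp)
    (R : realType) (d : nat) (X : 'I_d -> T -> R) (F : 'rV[R]_d -> R) (w : T) :
  (forall i, 0 <= X i w) -> {within orthant R d, continuous F} ->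
  F (sampled_point X n w) @[n --> \oo] --> F (\row_i X i w).
Proof.
move=> X0 /subspace_continuousP cF.
have xO : orthant R d (\row_i X i w) by move=> i; rewrite mxE.
apply: (@cvg_comp _ _ _ (fun n => sampled_point X n w) F _ _ _ _ (cF _ xO)).
move=> B; rewrite /within/= => oB.
have xB : sampled_point X n w @[n --> \oo] --> (\row_i X i w).
  by apply: cvg_row => i; exact: grid_value_index_cvg.
have xBn : \forall n \near \oo, orthant R d (sampled_point X n w) ->
    B (sampled_point X n w) := xB _ oB.
change (\forall n \near \oo, B (sampled_point X n w)).
by apply: filterS xBn => n; apply; exact: orthant_sampled_point.
Qed.

Lemma generated_sigma_cell (disp : measure_display) (T : measurableType disp)
    (R : realType) (d : nat) (I : Type) (D : set I) (Y : I -> T -> R)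
    (X : 'I_d -> T -> R) (n : nat) (g : {ffun 'I_d -> 'I_(n.+1 * n.+1).+1}) :
  (forall i, exists2 t, D t & X i = Y t) ->
  generated_sigma D Y (cell X g).
Proof.
move=> XY; pose S : set_system T :=
  \bigcup_(i in D) preimage_set_system setT (Y i) measurable.
(* [T] is re-equipped with the generated sigma-algebra, so that membership becomes measurability of
   a finite intersection. *)
apply: (@fin_bigcap_measurable _ (g_sigma_algebraType S)) => // i _.
have [t Dt ->] := XY i.
exact: (generated_sigma_preimage (X := Y) Dt (measurable_grid_index (g i))).
Qed.
Theorem theorem6p1 (R : realType) (disp : measure_display)
    (Omega : measurableType disp) (P : probability Omega R)
    (P_complete : measure_is_complete P)
    (d : nat) (d_ge2 : (2 <= d)%N)
    (T : 'I_d -> R) (T_gt0 : forall i, 0 < T i)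
    (W : 'rV[R]_d -> Omega -> R) (qW : 'rV[R]_d -> 'rV[R]_d -> R)
    (W_gaussian : gaussian_field P (orthant R d) W)
    (W_centered : centered_field P (orthant R d) W)
    (W_continuous : continuous_field P (orthant R d) W)
    (W_measurable : jointly_measurable W)
    (W_cov : covariance_function P (orthant R d) W qW)
    (l : 'I_d -> R -> Omega -> R)
    (l_subordinator : forall k, levy_subordinator P (T k) (l k))
    (l_indep : mutually_independent P
       (fun k : 'I_d => generated_sigma [set` `[0, T k]] (l k)))
    (l_W_indep : independent2 P
       (generated_sigma [set kt : 'I_d * R | kt.2 \in `[0, T kt.1]]
          (fun kt => l kt.1 kt.2))
       (generated_sigma (orthant R d) W))
    (N : nat) (N_gt0 : (0 < N)%N)
    (c : 'I_N -> R) (c_ge0 : forall j, 0 <= c j)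
    (alpha : 'I_N -> 'I_d -> R) (alpha_ge0 : forall j i, 0 <= alpha j i)
    (sigmaW_le : forall x, orthant R d x ->
       Num.sqrt (qW x x) <= \sum_(j < N) c j * monomial x (alpha j))
    (x : 'rV[R]_d) (x_in : forall i, x ord0 i \in `[0, T i])
    (f : 'I_d -> R -> R)
    (f_density : forall i, has_density P (l i (x ord0 i)) (f i))
    (eta : 'I_d -> R) (K C : R) (K_gt0 : 0 < K) (C_gt0 : 0 < C)
    (f_le : forall i z, K <= z -> f i z <= C * `|z| `^ (- eta i))
    (p : R) (p_ge1 : 1 <= p) (p_lt : (p%:E < moment_bound eta alpha)%E) :
  subordinated_field W l x \in Lfun P p%:E.
Proof.
pose X i : Omega -> R := l i (x ord0 i).
have mX i : measurable_fun setT (X i).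
  by have [[/(_ _ (x_in i))]] := l_subordinator i.
have XW i : exists2 t, [set kt : 'I_d * R | kt.2 \in `[0, T kt.1]] t &
    X i = l t.1 t.2 by exists (i, x ord0 i) => //=; exact: x_in.
have gW y : orthant R d y -> gaussian_rv P (W y).
  move=> Oy; have := W_gaussian 1 (fun=> y) (fun=> Oy) (fun=> 1).
  by congr (gaussian_rv P _); apply/funext => w; rewrite big_ord1 mul1r.
have mW y : orthant R d y -> measurable_fun setT (W y) by move=> /gW[].
have p_gt0 : 0 < p by exact: lt_le_trans p_ge1.
have [c0 c0_ge0 c0W] := gaussian_moment_le P (ltW p_gt0).
have Wp y : orthant R d y -> (\int[P]_w (`|W y w| `^ p)%:E <=
    (c0 * (\sum_j c j * monomial y (alpha j)) `^ p)%:E)%E.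
  move=> Oy; apply: le_trans (c0W (W y) (qW y y) (gW y Oy) _) _.
    by have := W_cov y y Oy Oy; rewrite unlock.
  rewrite lee_fin ler_wpM2l// ge0_ler_powR ?nnegrE ?(ltW p_gt0) ?sqrtr_ge0//.
    apply: sumr_ge0 => j _; rewrite mulr_ge0// prodr_ge0// => i _.
    exact: powR_ge0.
  exact: sigmaW_le.
have Xfin j i : (\int[P]_w (Num.max (X i w) 0 `^ (alpha j i * p))%:E)%E \is a fin_num.
  rewrite ge0_fin_numE; last by apply: integral_ge0 => w _; rewrite lee_fin powR_ge0.
  (* Zero exponents are left out of the minimum defining [moment_bound]; their moment is the
     integral of 1, as [0 ^ 0 = 1]. *)
  have [a0|a0] := eqVneq (alpha j i) 0.
    under eq_integral do rewrite a0 mul0r powRr0.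
    by rewrite integral_cst// mul1e (le_lt_trans (probability_le1 _ _))// ltry.
  apply: (tail_moment_lty (mX i) (f_density i) K_gt0 C_gt0 (f_le i)).
    by rewrite mulr_ge0// ltW.
  exact: moment_bound_lt p_lt.
pose M j i := fine (\int[P]_w (Num.max (X i w) 0 `^ (alpha j i * p))%:E)%E.
apply: (@Lfun_ae_cvg _ _ _ P (fun n w => W (sampled_point X n w) w) _ p
  (c0 * (N%:R `^ p * \sum_j c j `^ p * \prod_i M j i))) => //.
- by move=> n; exact: measurable_sampled_field.
(* Almost surely [l_i] starts at 0 and is nondecreasing, so the limit point lies in the orthant and
   rounding converges to it. *)
- have X0 : {ae P, forall w, forall i, 0 <= X i w}.
    apply: filter_forall => i.
    have [[_ l0 _ _ _] lmono] := l_subordinator i.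
    have := x_in i; rewrite in_itv/= => /andP[x0 xT].
    apply: filterS2 l0 lmono => w l0 lmono.
    by rewrite -l0 lmono.
  apply: filterS2 X0 W_continuous => w X0 Wc.
  exact: (@sampled_point_cvg _ _ R d X (W^~ w)  w X0 Wc).
- move=> n; apply: sampled_moment_le => //.
  + move=> g; rewrite /cell l_indep => [|i _].
      by apply: eq_bigl => i; rewrite finset.in_setT.
    apply: (generated_sigma_preimage (X := l i)); first exact: x_in.
    exact: measurable_grid_index.
  + move=> g y A Oy mA; apply: l_W_indep.
      exact: generated_sigma_cell.
    exact: (generated_sigma_preimage (X := W)).
  + exact: ltW.
  + by move=> j i; rewrite fineK.
Qed.
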